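(* Let $\eta>0$ be fixed. Let $\{X_n\}_{n\in\mathbb{N}}$ be a sequence of i.i.d. real random variables with $E(X_1)=0$ and $\mathrm{Var}(X_1)=1$. For each $\lambda>0$ let $K\sim\mathrm{COMP}(\lambda,\eta)$ be independent of the $X_n$'s. Then $$\widetilde S_\lambda\equiv a_\lambda\sum_{i=1}^{K}X_i\ \xrightarrow{d}\ N(0,1)\quad\text{as }\lambda\to\infty,$$ where $a_\lambda=\lambda^{-\frac{1}{2\eta}}$.
   Context: Conway-Maxwell-Poisson distribution: for $\lambda>0$ and $\eta>0$, $K\sim\mathrm{COMP}(\lambda,\eta)$ means $$P(K=j)=\frac{\lambda^j}{(j!)^\eta}\frac{1}{H(\lambda,\eta)},\quad j=0,1,2,\ldots,\qquad H(\lambda,\eta)=\sum_{i=0}^\infty\frac{\lambda^i}{(i!)^\eta}.$$ An empty sum ($K=0$) equals $0$. $\xrightarrow{d}$ denotes convergence in distribution. *)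

(* Defs.v *)
From HB Require Import structures.
From mathcomp Require Import all_boot all_order all_algebra finmap.
From mathcomp Require Import all_classical all_reals all_analysis measurable_realfun.

Set Implicit Arguments.
Unset Strict Implicit.
Unset Printing Implicit Defensive.

Import Order.TTheory GRing.Theory Num.Theory.
Import numFieldNormedType.Exports.

Local Open Scope classical_set_scope.
Local Open Scope ring_scope.

Section comp_distribution.
Context {R : realType}.

Definition comp_weight (lambda eta : R) (j : nat) : R :=
  lambda ^+ j / (j`!%:R `^ eta).

Definition comp_normalizer (lambda eta : R) : R :=
  limn (series (comp_weight lambda eta)).

Definition comp_pmf (lambda eta : R) (j : nat) : R :=
  comp_weight lambda eta j / comp_normalizer lambda eta.

Definition comp_distributed d (T : measurableType d) (P : probability T R)
    (K : {RV P >-> nat}) (lambda eta : R) : Prop :=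
  forall j : nat, distribution P K [set j] = (comp_pmf lambda eta j)%:E.

End comp_distribution.

Section independence.
Context d (T : measurableType d) (R : realType) (P : probability T R).

Definition mutually_independent (I : choiceType) d' (T' : measurableType d')
    (X : I -> {RV P >-> T'}) : Prop :=
  forall (J : {fset I}) (B : I -> set T'),
    (forall i, measurable (B i)) ->
    P (\bigcap_(i in [set` J]) (X i @^-1` B i)) =
    (\prod_(i <- J) P (X i @^-1` B i))%E.

(* Equality is only required on measurable sets: outside of them the library's
   measures take unspecified values. *)
Definition identically_distributed I d' (T' : measurableType d')
    (X : I -> {RV P >-> T'}) : Prop :=
  forall (i j : I) (B : set T'), measurable B ->
    distribution P (X i) B = distribution P (X j) B.

Definition iid (I : choiceType) d' (T' : measurableType d')
    (X : I -> {RV P >-> T'}) : Prop :=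
  mutually_independent X /\ identically_distributed X.

Definition sigma_generated I d' (T' : measurableType d')
    (X : I -> {RV P >-> T'}) : set (set T) :=
  <<s \bigcup_i preimage_set_system setT (X i) measurable >>.

Definition independent_of_family I d1 d2 (T1 : measurableType d1)
    (T2 : measurableType d2) (K : {RV P >-> T1}) (X : I -> {RV P >-> T2}) :
    Prop :=
  forall (A : set T1) (E : set T), measurable A -> sigma_generated X E ->
    P ((K @^-1` A) `&` E) = (P (K @^-1` A) * P E)%E.

End independence.

(* Convergence of distribution functions at the continuity points of that of
   the limit law mu, along a filter F on the index type. *)
Definition cvg_in_distribution d (T : measurableType d) (R : realType)
    (P : probability T R) (I : Type) (F : set_system I)
    (Y : I -> {RV P >-> R}) (mu : probability (measurableTypeR R) R) : Prop :=
  forall x : R, {for x, continuous (fun y : R => mu `]-oo, y]%classic)} ->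
    cdf (Y i) x @[i --> F] --> mu `]-oo, x]%classic.

(* The sequence is indexed from 0, so X i stands for the (i+1)-st term. *)
Definition random_sum d (T : measurableType d) (R : realType)
    (X : nat -> {mfun T >-> R}) (K : {mfun T >-> nat}) : T -> R :=
  fun t => \sum_(i < K t) X i t.

Section random_sum_measurable.
Context d (T : measurableType d) (R : realType).
Variables (X : nat -> {mfun T >-> R}) (K : {mfun T >-> nat}).

Lemma measurable_random_sum : measurable_fun setT (random_sum X K).
Proof.
move=> _ B mB; rewrite setTI.
have -> : random_sum X K @^-1` B = \bigcup_n
    ((K @^-1` [set n]) `&` ((fun t => \sum_(i < n) X i t) @^-1` B)).
  apply/seteqP; split=> [t Bt|t [n _ [/= <-]]]; last exact.
  by exists (K t).
apply: bigcup_measurable => n _; apply: measurableI.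
  exact: measurable_funPTI.
rewrite -[X in measurable X]setTI.
by apply: measurable_sum => // i; exact: measurable_funP.
Qed.

HB.instance Definition _ := isMeasurableFun.Build _ _ _ _
  (random_sum X K) measurable_random_sum.

End random_sum_measurable.

(* Main.v *)
(* The function [(v, w) |-> Phi (w / sqrt v)], with [Phi] the normal distribution
   function, solves the heat equation. Hence, when one summand [a X_k] is added
   to [w] while the "time" [v] decreases by [a ^ 2], the expectation of this
   function changes only by [o(a ^ 2)], uniformly in [w]. Telescoping over the
   first [j] summands gives, for every [j],
     |E Phi ((c - a S_j) / sqrt v) - Phi (c / sqrt (v + j a ^ 2))| <= j o(a ^ 2),
   a Lindeberg argument which needs neither characteristic functions nor the
   convolution of Gaussian laws. Since [Phi ((c - u) / sqrt v)] is a smooth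
   approximation of the indicator of [u <= c], the law of [a S_j] is uniformly
   close to N(0,1) as long as [j a ^ 2] is close to 1. Conditionally on [K = j]
   the random sum is [S_j], so it remains to see that [K a ^ 2 -> 1] in
   probability, where [a ^ 2 = 1 / q] and [q = lambda ^ (1 / eta)]. This holds
   because P(K = j + 1) / P(K = j) = (q / (j + 1)) ^ eta is at most a constant
   less than 1 for [j >= (1 + delta) q], and at least a constant greater than 1
   for [j <= (1 - delta) q]: both tails decay geometrically. *)

Require Import Defs.
From HB Require Import structures.
From mathcomp Require Import all_boot all_order all_algebra finmap.
From mathcomp Require Import all_classical all_reals all_analysis measurable_realfun.
From mathcomp Require Import ring lra.
Set Implicit Arguments.
Unset Strict Implicit.
Unset Printing Implicit Defensive.
Import Order.TTheory GRing.Theory Num.Theory.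
Import numFieldNormedType.Exports.
Local Open Scope classical_set_scope.
Local Open Scope ring_scope.

(** * Gaussian expansions *)

Section mean_value.
Context {R : realType}.
Implicit Types f df : R -> R.

(** The endpoints are left unordered because increments in the Taylor expansions may be negative. *)
Lemma mean_value_le f df (a b B : R) :
  (forall z, Num.min a b <= z <= Num.max a b -> is_derive z 1 f (df z)) ->
  (forall z, Num.min a b <= z <= Num.max a b -> `|df z| <= B) ->
  `|f b - f a| <= B * `|b - a|.
Proof.
wlog ab : a b / a <= b => [wh|] dfP dfB.
  have [/wh|/ltW ba] := leP a b; first exact.
  by rewrite distrC (distrC b); apply: wh => // z; rewrite minC maxC; [exact: dfP|exact: dfB].
rewrite min_l// max_r// in dfP dfB.
have [||c cab ->] := @MVT_segment R f df a b ab.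
- move=> z; rewrite in_itv/= => /andP[az zb]; apply: dfP.
  by rewrite !ltW.
- apply: derivable_within_continuous => z; rewrite in_itv/= => zab.
  exact: @ex_derive _ _ _ _ _ _ _ (dfP z zab).
- by rewrite normrM ler_wpM2r// dfB//; move: cab; rewrite in_itv.
Qed.

End mean_value.

(** * The standard normal density and distribution function *)

Section gaussian_cdf.
Context {R : realType}.
Implicit Types (x y z h : R).

Definition gauss_pdf : R -> R := normal_pdf 0 1.

Definition gauss_cdf x : R := \int[lebesgue_measure]_(y in `]-oo, x]) gauss_pdf y.

Lemma gauss_cdfE x : (gauss_cdf x)%:E = normal_prob (0 : R) 1 `]-oo, x]%classic.
Proof.
rewrite /gauss_cdf /Rintegral -/(normal_prob 0 1 _) fineK//.
exact: (fin_num_measure (normal_prob (0 : R) 1)).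
Qed.

Lemma gauss_pdfE x : gauss_pdf x = normal_peak 1 * expR (- (x ^+ 2 / 2)).
Proof.
by rewrite /gauss_pdf normal_pdfE ?oner_neq0// /normal_fun subr0 expr1n mulNr.
Qed.

Lemma gauss_pdf_ge0 x : 0 <= gauss_pdf x.
Proof. exact: normal_pdf_ge0. Qed.

Lemma is_derive_gauss_cdf x : is_derive x 1 gauss_cdf (gauss_pdf x).
Proof.
have [] := @continuous_FTC1 R gauss_pdf -oo%O x (x + 1) _ _ _ _.
- by rewrite ltrDl.
- by apply: (integrableS _ _ (subsetT _)) => //; exact: integrable_normal_pdf.
- by rewrite ltNyr.
- exact: continuous_normal_pdf.
- by move=> dF F'; apply: DeriveDef => //; rewrite -derive1E.
Qed.

Lemma is_derive_gauss_pdf x : is_derive x 1 gauss_pdf (- (x * gauss_pdf x)).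
Proof.
have -> : gauss_pdf = (fun y => normal_peak 1 * expR (- (y ^+ 2 / 2))).
  by apply/funext => y; rewrite gauss_pdfE.
apply: is_derive_eq; rewrite ?scaler0 ?add0r ?addr0 /GRing.scale/=.
by field.
Qed.

Lemma is_derive_gauss_pdf2 x :
  is_derive x 1 (fun y => - (y * gauss_pdf y)) ((x ^+ 2 - 1) * gauss_pdf x).
Proof.
have ? := is_derive_gauss_pdf x.
by apply: is_derive_eq; rewrite /GRing.scale/=; ring.
Qed.

(** With [u = z ^+ 2], [1 + u <= 4 (1 + u / 4) <= 4 exp (u / 4)], and squaring cancels the
    exponential of the density. The quartic factor dominates every polynomial that multiplies the
    density in the derivatives below. *)
Lemma gauss_pdf_decay : exists2 C : R, 0 < C &
  forall z, (1 + z ^+ 2) ^+ 2 * gauss_pdf z <= C.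
Proof.
exists (16 * normal_peak 1); first by rewrite mulr_gt0// normal_peak_gt0// oner_neq0.
move=> z; rewrite gauss_pdfE mulrCA mulrC ler_wpM2r ?normal_peak_ge0//.
rewrite expRN ler_pdivrMr ?expR_gt0//.
have -> : z ^+ 2 / 2 = z ^+ 2 / 4 + z ^+ 2 / 4 by field.
have h : 1 + z ^+ 2 / 4 <= expR (z ^+ 2 / 4) by exact: expR_ge1Dx.
rewrite expRD; set e := expR _ in h *.
have := sqr_ge0 z; move: (z ^+ 2) h => u h u0.
nra.
Qed.

Lemma gauss_cdf_ge0 x : 0 <= gauss_cdf x.
Proof. by rewrite -lee_fin gauss_cdfE. Qed.

Lemma gauss_cdf_le1 x : gauss_cdf x <= 1.
Proof. by rewrite -lee_fin gauss_cdfE; exact: (@probability_le1 _ _ _ (normal_prob (0 : R) 1)). Qed.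

Lemma gauss_cdf_nondecreasing x y : x <= y -> gauss_cdf x <= gauss_cdf y.
Proof.
move=> xy; rewrite -lee_fin !gauss_cdfE.
apply: (@le_measure _ _ _ (normal_prob (0 : R) 1)); rewrite ?inE//.
exact: subset_itvl.
Qed.

Lemma continuous_gauss_cdf : continuous gauss_cdf.
Proof.
move=> x; apply: differentiable_continuous; apply/derivable1_diffP.
exact: @ex_derive _ _ _ _ _ _ _ (is_derive_gauss_cdf x).
Qed.

Lemma measurable_gauss_cdf : measurable_fun setT gauss_cdf.
Proof. exact: continuous_measurable_fun continuous_gauss_cdf. Qed.


End gaussian_cdf.

Section tails.
Context {R : realType}.
(** The identity is a random variable of law N(0,1), so the limits of [cdf] at both infinities
    apply; one [M] dominates both thresholds. *)
Lemma gauss_cdf_tails e : 0 < e ->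
  exists2 M : R, 0 < M & forall x, (M <= x -> 1 - e <= gauss_cdf x) /\
                     (x <= - M -> gauss_cdf x <= e).
Proof.
move=> e0.
pose P := normal_prob (0 : R) 1.
pose X : {RV P >-> R} := @mfun_Sub _ _ (measurableTypeR R) R idfun (mem_set (@measurable_id _ _ setT)).
have /fine_cvgP[_ /cvgrPdist_le/(_ e e0)[A [_ hA]]] := cvg_cdfy1 X.
have /fine_cvgP[_ /cvgrPdist_le/(_ e e0)[B [_ hB]]] := cvg_cdfNy0 X.
have cdfE x : fine (cdf X x) = gauss_cdf x.
  by rewrite -[gauss_cdf x]/(fine (gauss_cdf x)%:E) gauss_cdfE.
exists (`|A| + `|B| + 1); first by rewrite ltr_pwDr// addr_ge0.
have := ler_norm A; have := ler_norm (- B); rewrite normrN => B0 A0.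
have := normr_ge0 A; have := normr_ge0 B => B1 A1.
move=> x; split=> xM; rewrite -cdfE.
  have /hA/= : A < x by lra.
  move/(le_trans (ler_norm _)); lra.
have /hB/= : x < B by lra.
rewrite sub0r normrN; move/(le_trans (ler_norm _)); lra.
Qed.
End tails.

Section taylor.
Context {R : realType}.

(* The constants are not optimal: only the orders of magnitude matter. *)
Lemma taylor_remainder (f f1 f2 f3 : R -> R) (C x h : R) :
  (forall z : R, is_derive z 1 f (f1 z)) -> (forall z : R, is_derive z 1 f1 (f2 z)) ->
  (forall z : R, is_derive z 1 f2 (f3 z)) ->
  (forall z, `|f2 z| <= C) -> (forall z, `|f3 z| <= C) ->
  `|f (x + h) - f x - h * f1 x - h ^+ 2 / 2 * f2 x| <=
    2 * C * Num.min (h ^+ 2) (`|h| ^+ 3).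
Proof.
move=> d1 d2 d3 b2 b3.
have C0 : 0 <= C by apply: le_trans (b2 0).
have between z : Num.min x (x + h) <= z <= Num.max x (x + h) -> `|z - x| <= `|h|.
  rewrite ge_min le_max ler_norml => /andP[].
  have := ler_norm h; have := ler_norm (- h); rewrite normrN.
  move=> ? ? /orP[]? /orP[]?; apply/andP; split; lra.
have e1 z : `|f1 z - f1 x| <= C * `|z - x|.
  by apply: mean_value_le => // y _; exact: b2.
have e2 z : `|f2 z - f2 x| <= C * `|z - x|.
  by apply: mean_value_le => // y _; exact: b3.
(* Subtracting the tangent of [f1] at [x] gains one order; this feeds the cubic bound. *)
have r1 z : `|z - x| <= `|h| -> `|f1 z - f1 x - (z - x) * f2 x| <= C * `|h| ^+ 2.
  move=> zh.
  have := @mean_value_le R (fun y => f1 y - (y - x) * f2 x) (fun y => f2 y - f2 x) x z (C * `|z - x|).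
  rewrite subrr mul0r subr0 addrAC => h1; apply: le_trans (h1 _ _) _ => [y _|y yz|].
  - have ? := d2 y; apply: is_derive_eq; rewrite /GRing.scale/=; ring.
  - apply: le_trans (e2 y) _; rewrite ler_wpM2l//.
    move: yz; rewrite ge_min le_max ler_norml => /andP[].
    have := ler_norm (z - x); have := ler_norm (- (z - x)); rewrite normrN.
    move=> ? ? /orP[]? /orP[]?; apply/andP; split; lra.
  - by rewrite -mulrA -expr2 ler_wpM2l// lerXn2r// nnegrE.
(* If [h ^+ 2] is the minimum, a first-order expansion suffices and the second-order term is bounded
   on its own. Otherwise the second-order remainder has a derivative controlled by [r1]. *)
rewrite minEle; case: ifPn => _.
- have := @mean_value_le R (fun y => f y - (y - x) * f1 x) (fun y => f1 y - f1 x) x (x + h) (C * `|h|).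
  rewrite subrr mul0r subr0 (addrC x h) addrK addrAC -[C * _ * _]mulrA -expr2 real_normK ?num_real// => h1.
  have {}h1 : `|f (h + x) - f x - h * f1 x| <= C * h ^+ 2.
    apply: h1 => [y _|y yz].
    - have ? := d1 y; apply: is_derive_eq; rewrite /GRing.scale/=; ring.
    - by apply: le_trans (e1 y) _; rewrite ler_wpM2l// between// (addrC x).
  apply: le_trans (ler_normB _ _) _.
  have h2 : `|h ^+ 2 / 2 * f2 x| <= h ^+ 2 / 2 * C.
    by rewrite normrM ger0_norm ?divr_ge0 ?sqr_ge0// ler_wpM2l ?divr_ge0 ?sqr_ge0.
  have := sqr_ge0 h; nra.
- have := @mean_value_le R (fun y => f y - (y - x) * f1 x - (y - x) ^+ 2 / 2 * f2 x)
    (fun y => f1 y - f1 x - (y - x) * f2 x) x (x + h) (C * `|h| ^+ 2).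
  rewrite subrr expr0n/= !mul0r !subr0 (addrC x h) addrK => h1.
  have {}h1 : `|f (h + x) - h * f1 x - h ^+ 2 / 2 * f2 x - f x| <= C * `|h| ^+ 3.
    rewrite (exprSr _ 2) mulrA; apply: h1 => [y _|y yz].
    - have ? := d1 y; by apply: is_derive_eq; rewrite /GRing.scale/=; field.
    - by apply: r1; apply: between; rewrite (addrC x).
  have -> : f (h + x) - f x - h * f1 x - h ^+ 2 / 2 * f2 x =
    f (h + x) - h * f1 x - h ^+ 2 / 2 * f2 x - f x by ring.
  apply: le_trans h1 _; rewrite -mulrA ler_peMl ?ler1n// mulr_ge0// exprn_ge0//.
Qed.

End taylor.

Section gaussian_expansions.
Context {R : realType}.

(** First-order expansion of [t |-> gauss_cdf (w / t)] at [s], expressed through the increment of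
    the variance so that it can cancel the quadratic term of an expansion in space. It is uniform in
    [w] because [w] enters the second derivative only through [w / t], against the decay of the
    density. *)
Lemma gauss_cdf_rescale : exists2 C : R, 0 < C & forall w s S : R, 0 < s -> s <= S ->
  `|gauss_cdf (w / S) - gauss_cdf (w / s) +
    (S ^+ 2 - s ^+ 2) / (2 * s ^+ 2) * (w / s * gauss_pdf (w / s))| <=
  C * ((S ^+ 2 - s ^+ 2) / s ^+ 2) ^+ 2.
Proof.
have [C C0 hC] := @gauss_pdf_decay R; exists C => // w s S s0 sS.
pose f t : R := gauss_cdf (w / t).
pose f1 t : R := - (w / t ^+ 2 * gauss_pdf (w / t)).
pose f2 t : R := (2 * (w / t) - (w / t) ^+ 3) * gauss_pdf (w / t) / t ^+ 2.
have dw (t : R) : 0 < t -> is_derive t 1 (fun t => w / t) (- (w / t ^+ 2)).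
  move=> t0; have t0' : t != 0 by rewrite gt_eqF.
  have ? : is_derive t 1 (fun y : R => y^-1) (- t ^- 2 *: 1).
    exact: (is_deriveV t0' (is_derive_id t 1)).
  by apply: is_derive_eq; rewrite /GRing.scale/=; field.
have d1 (t : R) : 0 < t -> is_derive t 1 f (f1 t).
  move=> t0; have := @is_derive1_comp _ _ (fun y : R => w / y) _ _ _ (is_derive_gauss_cdf (w / t)) (dw t t0).
  by rewrite mulrN mulrC.
have d2 (t : R) : 0 < t -> is_derive t 1 f1 (f2 t).
  move=> t0; have t0' : t != 0 by rewrite gt_eqF.
  have /= := @is_derive1_comp _ _ (fun y : R => w / y) _ _ _ (is_derive_gauss_pdf (w / t)) (dw t t0).
  rewrite /comp => ?.
  have t2 : t ^+ 2 != 0 by rewrite expf_neq0.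
  have ? : is_derive t 1 (fun y : R => (y ^+ 2)^-1) (- (t ^+ 2) ^- 2 *: (2 * t)).
    apply: (@is_deriveV _ (fun y : R => y ^+ 2) t (2 * t) 1 t2).
    by apply: is_derive_eq; rewrite /GRing.scale/=; ring.
  apply: is_derive_eq; rewrite /GRing.scale/= /f2; field.
  by rewrite t0'.
have b2 t : s <= t -> `|f2 t| <= C / s ^+ 2.
  move=> st; have t0 : 0 < t by apply: lt_le_trans st.
  rewrite /f2 normrM normfV (ger0_norm (sqr_ge0 t)).
  apply: ler_pM; rewrite ?invr_ge0 ?sqr_ge0//; last first.
    by rewrite lef_pV2 ?posrE ?exprn_gt0// lerXn2r// nnegrE ltW.
  apply: le_trans (hC (w / t)); rewrite normrM (ger0_norm (gauss_pdf_ge0 _)).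
  rewrite ler_wpM2r ?gauss_pdf_ge0//; move: (w / t) => z.
  rewrite ler_norml; have := sqr_ge0 (z - 1); have := sqr_ge0 (z + 1).
  have := sqr_ge0 z; have := sqr_ge0 (z * (z - 1)); have := sqr_ge0 (z * (z + 1)).
  by move=> *; apply/andP; split; nra.
have between (y t : R) : s <= y -> Num.min s y <= t <= Num.max s y -> s <= t <= y.
  by move=> sy; rewrite min_l// max_r.
have e1 y : s <= y -> `|f1 y - f1 s| <= C / s ^+ 2 * (y - s).
  move=> sy; have ys : `|y - s| = y - s by rewrite ger0_norm// subr_ge0.
  rewrite -[in leRHS]ys; apply: (@mean_value_le R f1 f2) => t /(between _ _ sy)/andP[st _].
    by apply: d2; apply: lt_le_trans st.
  exact: b2.
have := @mean_value_le R (fun y => f y - (y - s) * f1 s) (fun y => f1 y - f1 s) s S (C / s ^+ 2 * (S - s)).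
rewrite subrr mul0r subr0 [in leRHS]ger0_norm ?subr_ge0// => h1.
have {h1} : `|f S - (S - s) * f1 s - f s| <= C / s ^+ 2 * (S - s) * (S - s).
  apply: h1 => t /(between _ _ sS)/andP[st tS].
    have ? := d1 t (lt_le_trans s0 st).
    by apply: is_derive_eq; rewrite /GRing.scale/=; ring.
  apply: le_trans (e1 t st) _; apply: ler_wpM2l; last lra.
  by rewrite divr_ge0 ?sqr_ge0// ltW.
rewrite /f /f1; set p := gauss_pdf (w / s) => h1.
have hp : `|w / s * p| <= C.
  apply: le_trans (hC (w / s)); rewrite normrM (ger0_norm (gauss_pdf_ge0 _)).
  rewrite ler_wpM2r ?gauss_pdf_ge0//; move: (w / s) => z.
  rewrite ler_norml; have := sqr_ge0 (z - 1); have := sqr_ge0 (z + 1).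
  by have := sqr_ge0 z => *; apply/andP; split; nra.
have sn0 : s != 0 by rewrite gt_eqF.
(* The relative variance increment is [k * (k + 2)], half of which is [k + k ^+ 2 / 2]: passing from
   the increment of [s] to that of [s ^+ 2] costs only a term of order [k ^+ 2]. *)
pose k := (S - s) / s; have k0 : 0 <= k by rewrite divr_ge0 ?subr_ge0// ltW.
have -> : gauss_cdf (w / S) - gauss_cdf (w / s) +
    (S ^+ 2 - s ^+ 2) / (2 * s ^+ 2) * (w / s * p) =
  (gauss_cdf (w / S) - (S - s) * - (w / s ^+ 2 * p) - gauss_cdf (w / s)) +
  k ^+ 2 / 2 * (w / s * p) by rewrite /k; field.
have -> : (S ^+ 2 - s ^+ 2) / s ^+ 2 = k * (k + 2) by rewrite /k; field.
apply: le_trans (ler_normD _ _) _.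
have h2 : `|k ^+ 2 / 2 * (w / s * p)| <= k ^+ 2 / 2 * C.
  by rewrite normrM ger0_norm ?ler_wpM2l// divr_ge0 ?sqr_ge0.
have h3 : C / s ^+ 2 * (S - s) * (S - s) = C * k ^+ 2 by rewrite /k; field.
have h4 : 0 <= C * k ^+ 2 by rewrite mulr_ge0 ?sqr_ge0// ltW.
have h5 : 0 <= C * k ^+ 2 * (k ^+ 2 + 4 * k) by rewrite mulr_ge0// addr_ge0 ?sqr_ge0// mulr_ge0.
rewrite h3 in h1; nra.
Qed.

(** The second and third derivatives of [gauss_cdf] are bounded by [gauss_pdf_decay]. In the
    remainder, [h ^+ 2] ensures integrability under a second moment, and the cube ensures that it is
    negligible for small [h]. *)
Lemma gauss_cdf_expansion : exists2 C : R, 0 < C & forall z h : R,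
  `|gauss_cdf (z + h) - gauss_cdf z - h * gauss_pdf z + h ^+ 2 / 2 * (z * gauss_pdf z)| <=
  C * Num.min (h ^+ 2) (`|h| ^+ 3).
Proof.
have [C C0 hC] := @gauss_pdf_decay R; exists (2 * C); first by rewrite mulr_gt0.
move=> z h.
have := @taylor_remainder R gauss_cdf gauss_pdf (fun y => - (y * gauss_pdf y))
  (fun x => (x ^+ 2 - 1) * gauss_pdf x) C z h.
rewrite mulrN opprK; apply.
- exact: is_derive_gauss_cdf.
- exact: is_derive_gauss_pdf.
- exact: is_derive_gauss_pdf2.
- move=> y; apply: le_trans (hC y); rewrite normrN normrM (ger0_norm (gauss_pdf_ge0 _)).
  rewrite ler_wpM2r ?gauss_pdf_ge0//.
  rewrite ler_norml; have := sqr_ge0 (y - 1); have := sqr_ge0 (y + 1).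
  by have := sqr_ge0 y => *; apply/andP; split; nra.
- move=> y; apply: le_trans (hC y); rewrite normrM (ger0_norm (gauss_pdf_ge0 _)).
  rewrite ler_wpM2r ?gauss_pdf_ge0//.
  by rewrite ler_norml; have := sqr_ge0 y => *; apply/andP; split; nra.
Qed.

(* One Lindeberg step: the function [(s, w) |-> gauss_cdf (w / s)] solves the
   heat equation in the time [s ^+ 2], so the term in [a ^+ 2] vanishes when
   [x] is averaged against a centered law of variance 1. *)
Lemma gauss_cdf_heat_step : exists2 C : R, 0 < C & forall d s S w a x : R,
  0 < d -> d <= 1 -> 0 < s -> d <= s ^+ 2 -> 0 <= S -> S ^+ 2 = s ^+ 2 + a ^+ 2 -> 0 <= a ->
  `|gauss_cdf ((w - a * x) / s) - gauss_cdf (w / S) + x * (a * gauss_pdf (w / s) / s)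
    + (x ^+ 2 - 1) * (a ^+ 2 * (w / s * gauss_pdf (w / s)) / (2 * s ^+ 2))| <=
  C / d ^+ 2 * (a ^+ 2 * Num.min (x ^+ 2) (a * `|x| ^+ 3) + a ^+ 4).
Proof.
have [C1 C10 h1] := gauss_cdf_rescale; have [C2 C20 h2] := gauss_cdf_expansion.
exists (C1 + C2); first by rewrite addr_gt0.
move=> d s S w a x d0 d1 s0 ds S0 SE a0.
have sn0 : s != 0 by rewrite gt_eqF.
have sS : s <= S by rewrite -ler_sqr ?nnegrE ?(ltW s0)// SE lerDl sqr_ge0.
have {h1} := h1 w s S s0 sS; have {h2} := h2 (w / s) (- (a * x / s)).
rewrite SE (_ : s ^+ 2 + a ^+ 2 - s ^+ 2 = a ^+ 2); last by ring.
rewrite -mulrBl sqrrN.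
set z := w / s; set p := gauss_pdf z => h2 h1.
(* Both [s] and [s ^+ 2] are at least [d], so the inverse second, third and fourth powers of [s] are
   all at most [d ^- 2]. *)
have d2 : d ^+ 2 <= d by rewrite expr2 ler_piMr// ltW.
have ds1 : d <= s by rewrite -ler_sqr ?nnegrE ?(ltW s0) ?(ltW d0)// (le_trans d2).
have e1 : C1 * (a ^+ 2 / s ^+ 2) ^+ 2 <= C1 / d ^+ 2 * a ^+ 4.
  rewrite -mulrA ler_pM2l// expr_div_n -exprM mulrC ler_wpM2r ?exprn_ge0//.
  by rewrite lef_pV2 ?posrE ?exprn_gt0// lerXn2r ?nnegrE ?exprn_ge0// ltW.
have e2 : Num.min ((a * x / s) ^+ 2) (`|- (a * x / s)| ^+ 3) <=
   a ^+ 2 * Num.min (x ^+ 2) (a * `|x| ^+ 3) / d ^+ 2.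
  rewrite [leRHS]mulrAC minr_pMr; last by rewrite divr_ge0 ?sqr_ge0.
  rewrite le_min !ge_min; apply/andP; split; apply/orP; [left|right].
    rewrite expr_div_n exprMn mulrAC ler_wpM2r ?sqr_ge0//.
    rewrite ler_wpM2l ?sqr_ge0//.
    by rewrite lef_pV2 ?posrE ?exprn_gt0// (le_trans d2).
  rewrite normrN !normrM normfV (ger0_norm a0) (gtr0_norm s0).
  rewrite !exprMn exprVn [leRHS]mulrA [_ / _ * a]mulrAC -exprSr mulrAC.
  rewrite ler_wpM2r ?exprn_ge0// ler_wpM2l ?exprn_ge0//.
  by rewrite lef_pV2 ?posrE ?exprn_gt0// (expr2 d) (exprS s) ler_pM// ltW.
(* The space expansion with increment [- (a * x / s)] minus the time expansion: their [z * p] terms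
   combine into the factor [x ^+ 2 - 1]. *)
have -> : gauss_cdf ((w - a * x) / s) - gauss_cdf (w / S) + x * (a * p / s)
    + (x ^+ 2 - 1) * (a ^+ 2 * (z * p) / (2 * s ^+ 2)) =
  (gauss_cdf ((w - a * x) / s) - gauss_cdf z - - (a * x / s) * p
   + (a * x / s) ^+ 2 / 2 * (z * p)) -
  (gauss_cdf (w / S) - gauss_cdf z + a ^+ 2 / (2 * s ^+ 2) * (z * p)).
  by field.
apply: le_trans (ler_normB _ _) _.
apply: le_trans (lerD h2 h1) _.
apply: le_trans (lerD (ler_wpM2l (ltW C20) e2) e1) _.
have q : 0 <= a ^+ 2 * Num.min (x ^+ 2) (a * `|x| ^+ 3) / d ^+ 2.
  rewrite divr_ge0 ?sqr_ge0// mulr_ge0 ?sqr_ge0//.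
  by rewrite le_min sqr_ge0 mulr_ge0// exprn_ge0.
have q' : 0 <= a ^+ 4 / d ^+ 2 by rewrite divr_ge0 ?sqr_ge0 ?exprn_ge0//.
set u := a ^+ 2 * _ in q *; set v := a ^+ 4 in q' *.
have -> : (C1 + C2) / d ^+ 2 * (u + v) = C1 * (u / d ^+ 2) + C1 * (v / d ^+ 2) +
   (C2 * (u / d ^+ 2) + C2 * (v / d ^+ 2)) by ring.
have -> : C1 / d ^+ 2 * v = C1 * (v / d ^+ 2) by ring.
have := mulr_ge0 (ltW C10) q; have := mulr_ge0 (ltW C20) q'.
lra.
Qed.

End gaussian_expansions.

(** * Independence *)

Section independent_pair.
Context d (T : measurableType d) (R : realType) (P : probability T R).
Variables (Z W : {RV P >-> R}).
Hypothesis ZW : forall A B : set R, measurable A -> measurable B ->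
  P (Z @^-1` A `&` W @^-1` B) = (P (Z @^-1` A) * P (W @^-1` B))%E.

Lemma integrable_boundedM (g h : R -> R) (C : R) : measurable_fun setT g ->
  (forall x, `|g x| <= C) -> P.-integrable setT (EFin \o (h \o W)) ->
  measurable_fun setT h ->
  P.-integrable setT (fun t => (g (Z t) * h (W t))%:E).
Proof.
move=> mg gC ih mh; apply: (@le_integrable _ _ _ P _ measurableT _ (fun t => (C * h (W t))%:E)).
- apply/measurable_EFinP; apply: measurable_funM; apply: measurableT_comp => //.
- move=> t _; rewrite lee_fin !normrM ler_wpM2r// (le_trans (gC _))//; exact: ler_norm.
- exact: (integrableZl measurableT C ih).
Qed.

(** By [ZW] the joint law agrees with the product of the marginals on rectangles, hence everywhere,
    and Fubini's theorem factors the integral. *)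
Lemma Rintegral_independentM (g h : R -> R) (C : R) : measurable_fun setT g ->
  (forall x, `|g x| <= C) -> P.-integrable setT (EFin \o (h \o W)) ->
  measurable_fun setT h ->
  \int[P]_t (g (Z t) * h (W t)) = (\int[P]_t g (Z t)) * \int[P]_t h (W t).
Proof.
move=> mg gC ih mh.
have mZW : measurable_fun setT (fun t => (Z t, W t)).
  by apply: measurable_fun_pair; exact: measurable_funP.
pose ZW_ : {RV P >-> (R * R)%type} :=
  @mfun_Sub _ _ T _ (fun t => (Z t, W t)) (mem_set mZW).
pose m1 := distribution P Z; pose m2 := distribution P W.
pose f (z : R * R) : \bar R := (g z.1 * h z.2)%:E.
have mf : measurable_fun setT f.
  by apply/measurable_EFinP; apply: measurable_funM; apply: measurableT_comp.
have mfg : P.-integrable setT (f \o ZW_) by exact: integrable_boundedM.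
have mhE : measurable_fun setT (EFin \o h) by exact/measurable_EFinP.
have mgE : measurable_fun setT (EFin \o g) by exact/measurable_EFinP.
have ihW : m2.-integrable setT (EFin \o h).
  by apply: integrable_pushforward => //; exact: measurable_funP.
have igZ : P.-integrable setT (EFin \o (g \o Z)).
  apply: measurable_bounded_integrable => //.
  - by rewrite (le_lt_trans (probability_le1 _ _))// ltry.
  - exact: measurableT_comp.
  - by exists C; split; [exact: num_real|move=> M CM t _ /=; rewrite (le_trans (gC _))// ltW].
rewrite /Rintegral.
transitivity (fine (\int[distribution P ZW_]_z f z)%E).
  by rewrite (integral_distribution (X := ZW_))//.
have mE : forall X : set (R * R), measurable X -> (m1 \x m2)%E X = distribution P ZW_ X.
  apply: product_measure_unique => A B mA mB.
  rewrite -[RHS]ZW//; congr (P _).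
rewrite (@eq_measure_integral _ _ _ setT (m1 \x m2)%E); last first.
  by move=> A mA _; rewrite /= mE.
(* The iterated integral of the absolute value is at most [C] times that of [h]. *)
have ifm : (m1 \x m2)%E.-integrable setT f.
  apply/integrable12ltyP => //.
  apply: (@le_lt_trans _ _ (\int[m1]_x (C%:E * \int[m2]_y `|(h y)%:E|))%E).
    apply: ge0_le_integral => //.
    - by move=> x _; exact: integral_ge0.
    - apply: (measurable_fun_fubini_tonelli_F (m2 := m2) (abse \o f)).
        exact: measurableT_comp.
      by move=> z; exact: abse_ge0.
    move=> x _; rewrite -ge0_integralZl//; last 2 first.
      by apply: measurableT_comp.
      by rewrite lee_fin; exact: le_trans (gC 0).
    apply: ge0_le_integral => //.
    - have mfx : measurable_fun setT (fun y => f (x, y)).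
        by apply/measurable_EFinP; exact: (measurable_funM (measurable_cst (g x)) mh).
      exact: (measurableT_comp (@abse_measurable _ setT) mfx).
    - by apply: measurable_funeM; exact: measurableT_comp.
    - by move=> y _; rewrite /f /= -EFinM lee_fin normrM ler_wpM2r.
  have -> := @integral_cst _ _ _ m1 setT measurableT (C%:E * \int[m2]_y `|(h y)%:E|)%E.
  set c := (X in (_ * X < _)%E); have -> : c = 1%E by exact: probability_setT.
  rewrite mule1.
  move/integrableP : ihW => [_ hoo].
  by rewrite lte_mul_pinfty// lee_fin; exact: le_trans (gC 0).
rewrite -integral12_prod_meas1// /fubini_F /f/=.
under eq_integral do under eq_integral do rewrite EFinM.
under eq_integral do rewrite (integralZl measurableT ihW).
have ifin : (\int[m2]_y (h y)%:E)%E \is a fin_num by exact: integrable_fin_num.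
rewrite -(fineK ifin).
have igm : m1.-integrable setT (EFin \o g).
  by apply: integrable_pushforward => //; exact: measurable_funP.
rewrite (integralZr measurableT igm) fineM//; last exact: integrable_fin_num.
congr (fine _ * _); first by rewrite integral_distribution.
by rewrite /=; congr fine; exact: (integral_distribution mhE ih).
Qed.

End independent_pair.

(** * Independence of a partial sum from the next term and from the index *)

Section partial_sums.
Context d (T : measurableType d) (R : realType) (P : probability T R).
Variable X : nat -> {RV P >-> R}.

Definition partial_sum (k : nat) : T -> R := fun t => \sum_(i < k) X i t.

Lemma measurable_partial_sum k : measurable_fun setT (partial_sum k).
Proof. by apply: measurable_sum => i; exact: measurable_funP. Qed.

HB.instance Definition _ k := isMeasurableFun.Build _ _ _ _
  (partial_sum k) (measurable_partial_sum k).

Lemma partial_sumS k t : partial_sum k.+1 t = partial_sum k t + X k t.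
Proof. by rewrite /partial_sum big_ord_recr. Qed.

(** Sums of measurable functions are measurable for the generated sigma-algebra. [G] is arbitrary
    because two generating systems occur: the rectangles of the first [k] variables, and the events
    of the whole family. *)
Lemma partial_sum_g_sigma k (G : set (set T)) :
  (forall i, (i < k)%N -> preimage_set_system setT (X i) measurable `<=` G) ->
  forall A, measurable A -> <<s G >> (partial_sum k @^-1` A).
Proof.
move=> XG A mA.
have mX i : (i < k)%N ->
    measurable_fun setT (X i : g_sigma_algebraType G -> measurableTypeR R).
  move=> ik _ B mB; apply: sub_sigma_algebra; apply: (XG i ik).
  by exists B.
have mS j : (j <= k)%N -> measurable_fun setT
    (partial_sum j : g_sigma_algebraType G -> measurableTypeR R).
  elim: j => [_|j IH jk].
    rewrite (_ : partial_sum 0 = cst 0); first exact: measurable_cst.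
    by apply/funext => t; rewrite /partial_sum big_ord0.
  rewrite (_ : partial_sum j.+1 = fun t => partial_sum j t + X j t).
    by apply: measurable_funD; [exact: IH (ltnW jk)|exact: mX].
  by apply/funext => t; rewrite partial_sumS.
by have := mS k (leqnn k) measurableT A mA; rewrite setTI.
Qed.

Hypothesis iX : mutually_independent X.

Lemma mutually_independent_initial k (B : nat -> set R) :
  (forall i, measurable (B i)) ->
  P (\bigcap_(i in `I_k) X i @^-1` B i) = (\prod_(i < k) P (X i @^-1` B i))%E.
Proof.
move=> mB; pose J := seq_fset tt (iota 0 k).
have -> : `I_k = [set` J].
  by apply/seteqP; split=> i /=; rewrite seq_fsetE mem_iota.
rewrite iX// -(big_mkord xpredT (fun i => P (X i @^-1` B i))).
rewrite /index_iota subn0; apply: perm_big; apply: uniq_perm.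
- exact: fset_uniq.
- exact: iota_uniq.
- by move=> i; rewrite seq_fsetE.
Qed.

(** A pi-system generating the sigma-algebra of the first [k] variables. *)
Definition rectangles k : set (set T) := [set E | exists B : nat -> set R,
  (forall i, measurable (B i)) /\ E = \bigcap_(i in `I_k) X i @^-1` B i].

Lemma rectangles_measurable k : rectangles k `<=` measurable.
Proof.
move=> _ [B [mB ->]]; apply: bigcap_measurableType => i _.
exact: measurable_funPTI.
Qed.

Lemma setI_closed_rectangles k : setI_closed (rectangles k).
Proof.
move=> _ _ [B [mB ->]] [C [mC ->]]; exists (fun i => B i `&` C i); split.
  by move=> i; exact: measurableI.
by rewrite -bigcapI.
Qed.

(** For fixed [B], both sides are finite measures of the event in the first [k] variables. They
    agree on the pi-system of rectangles, hence on the sigma-algebra it generates, which contains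
    the events of [partial_sum k]. *)
Lemma partial_sum_independent k (A B : set R) : measurable A -> measurable B ->
  P (partial_sum k @^-1` A `&` X k @^-1` B) =
  (P (partial_sum k @^-1` A) * P (X k @^-1` B))%E.
Proof.
move=> mA mB.
have mXB : measurable (X k @^-1` B) by exact: measurable_funPTI.
pose p := NngNum (fine_ge0 (measure_ge0 P (X k @^-1` B))).
have pE : (p%:num)%:E = P (X k @^-1` B) by rewrite /= fineK// fin_num_measure.
rewrite muleC -pE.
apply: (@g_sigma_algebra_measure_unique _ R T (rectangles k)
  (@rectangles_measurable k) (fun=> setT) _ _ (mrestr P mXB) (mscale p P)
  (@setI_closed_rectangles k)).
- move=> _; exists (fun=> setT); split => //.
  by apply/seteqP; split.
- by apply/seteqP; split => // t _; exists 0%N.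
- move=> _ [C [mC ->]].
  (* Inserting [B] as side number [k] reduces the equality to independence of [k.+1] variables. *)
  pose C' i := if i == k then B else C i.
  have mC' i : measurable (C' i) by rewrite /C'; case: ifP.
  have h i : (i < k)%N -> C' i = C i by rewrite /C' => /ltn_eqF ->.
  have Ck : C' k = B by rewrite /C' eqxx.
  have := @mutually_independent_initial k.+1 C' mC'.
  rewrite big_ord_recr /= Ck.
  under eq_bigr => i _ do rewrite h//.
  rewrite -mutually_independent_initial// muleC -pE => mE.
  rewrite /mscale /mrestr -mE; congr (P _).
  apply/seteqP; split => [t [tC tB] i /=|t tC].
    by rewrite ltnS leq_eqVlt => /predU1P[->|ik]; rewrite /C' ?eqxx// ltn_eqF//; exact: tC.
  split; last by have := tC k (ltnSn k); rewrite /C' eqxx.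
  by move=> i ik; have := tC i (ltnW ik); rewrite h.
- move=> _; apply: le_lt_trans (ltry 1).
  by apply: probability_le1; exact: measurableI.
- apply: partial_sum_g_sigma => // i ik _ [C mC <-].
  exists (fun j => if j == i then C else setT); split => [j|]; first by case: ifP.
  rewrite setTI; apply/seteqP; split => [t tC j _ /=|t /(_ i ik)/=]; last by rewrite eqxx.
  by case: eqP => // ->.
Qed.

Lemma independent_partial_sum (K : {RV P >-> nat}) :
  independent_of_family K X ->
  forall j (A : set R), measurable A ->
  P (K @^-1` [set j] `&` partial_sum j @^-1` A) =
  (P (K @^-1` [set j]) * P (partial_sum j @^-1` A))%E.
Proof.
move=> KX j A mA; apply: KX => //.
rewrite /sigma_generated; apply: partial_sum_g_sigma => // i _ B [C mC <-].
by exists i => //; exists C.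
Qed.

End partial_sums.

(** * The Lindeberg argument *)

Section standardized_iid.
Context d (T : measurableType d) (R : realType) (P : probability T R).
Variable X : nat -> {RV P >-> R}.
Hypothesis iidX : iid X.
Hypothesis EX : 'E_P[X 0%N]%E = 0%E.
Hypothesis VX : 'V_P[X 0%N]%E = 1%E.

Lemma integrable_le_cst (f : T -> R) (C : R) : measurable_fun setT f ->
  (forall t, `|f t| <= C) -> P.-integrable setT (EFin \o f).
Proof.
move=> mf fC; apply: measurable_bounded_integrable => //.
- by rewrite (le_lt_trans (probability_le1 _ _))// ltry.
- by exists C; split; [exact: num_real|move=> M CM t _ /=; rewrite (le_trans (fC _))// ltW].
Qed.

Lemma Rintegral_probability_cst (r : R) : \int[P]_t r = r.
Proof.
rewrite (Rintegral_cst P measurableT) -[RHS]mulr1.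
by congr (_ * _); exact: (congr1 fine (probability_setT P)).
Qed.

Lemma second_moment : (\int[P]_t (X 0%N t ^+ 2)%:E = 1)%E.
Proof.
have := VX; rewrite /variance unlock EX /= unlock => <-.
apply: eq_integral => t _; rewrite (_ : ((_ * _) t) = (X 0%N t - 0) * (X 0%N t - 0)) => [|//].
by rewrite subr0 expr2.
Qed.

Lemma integrable_sqr : P.-integrable setT (EFin \o (fun t => X 0%N t ^+ 2)).
Proof.
apply/integrableP; split.
  by apply/measurable_EFinP; apply: measurable_funX; exact: measurable_funP.
under eq_integral => t _ do rewrite /= ger0_norm ?sqr_ge0//.
by rewrite second_moment ltry.
Qed.

Lemma first_moment : \int[P]_t X 0%N t = 0.
Proof. by have := EX; rewrite unlock /Rintegral => ->. Qed.

(** Domination by [1 + x ^+ 2]. *)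
Lemma integrable_first : P.-integrable setT (EFin \o X 0%N).
Proof.
have i1 : P.-integrable setT (EFin \o (cst 1 : T -> R)).
  by apply: (@integrable_le_cst _ 1) => // t; rewrite normr1.
apply: (le_integrable measurableT _ _ (integrableD measurableT i1 integrable_sqr)).
  by apply/measurable_EFinP; exact: measurable_funP.
move=> t _; rewrite /= lee_fin ler_norml.
have := sqr_ge0 (X 0%N t - 1); have := sqr_ge0 (X 0%N t + 1) => ? ?.
rewrite ger0_norm; last by rewrite addr_ge0 ?sqr_ge0.
by apply/andP; split; nra.
Qed.

Lemma integrable_copy (h : R -> R) k : measurable_fun setT h ->
  P.-integrable setT (EFin \o (h \o X 0%N)) ->
  P.-integrable setT (EFin \o (h \o X k)).
Proof.
move=> mh /integrableP[_ hoo]; apply/integrableP; split.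
  by apply/measurable_EFinP; apply: measurableT_comp => //; exact: measurable_funP.
apply: le_lt_trans hoo.
have mh' : measurable_fun setT (fun x => `|h x|%:E).
  by apply/measurable_EFinP; exact: measurableT_comp.
have h0 x : (0 <= `|h x|%:E)%E by rewrite lee_fin.
rewrite -(ge0_integral_distribution (X k) mh' h0) -(ge0_integral_distribution (X 0%N) mh' h0).
rewrite (@eq_measure_integral _ _ _ setT (distribution P (X 0%N)))// => A mA _.
exact: iidX.2.
Qed.

Lemma Rintegral_copy (h : R -> R) k : measurable_fun setT h ->
  P.-integrable setT (EFin \o (h \o X 0%N)) ->
  \int[P]_t h (X k t) = \int[P]_t h (X 0%N t).
Proof.
move=> mh ih; have mhE : measurable_fun setT (EFin \o h) by exact/measurable_EFinP.
congr fine.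
rewrite -(integral_distribution (X := X k) mhE (integrable_copy k mh ih)).
rewrite -(integral_distribution (X := X 0%N) mhE ih).
rewrite (@eq_measure_integral _ _ _ setT (distribution P (X 0%N)))// => A mA _.
exact: iidX.2.
Qed.

(** The expected Taylor remainder of a step [a * X], divided by [a ^+ 2]. *)
Definition cubic_remainder (a : R) : R :=
  \int[P]_t Num.min (X 0%N t ^+ 2) (a * `|X 0%N t| ^+ 3).

Lemma min_sqr_cube_ge0 (a x : R) : 0 <= a -> 0 <= Num.min (x ^+ 2) (a * `|x| ^+ 3).
Proof. by move=> a0; rewrite le_min sqr_ge0 mulr_ge0// exprn_ge0. Qed.

Lemma measurable_min_sqr_cube (a : R) : measurable_fun setT (fun x : R => Num.min (x ^+ 2) (a * `|x| ^+ 3)).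
Proof.
apply: measurable_minr; first exact: measurable_funX.
apply: measurable_funM => //; apply: measurable_funX.
exact: normr_measurable.
Qed.

Lemma integrable_min_sqr_cube (a : R) : 0 <= a ->
  P.-integrable setT (EFin \o ((fun x : R => Num.min (x ^+ 2) (a * `|x| ^+ 3)) \o X 0%N)).
Proof.
move=> a0; apply: (le_integrable measurableT _ _ integrable_sqr).
  by apply/measurable_EFinP; apply: (measurableT_comp (measurable_min_sqr_cube a)); exact: measurable_funP.
move=> t _; rewrite /= lee_fin (ger0_norm (min_sqr_cube_ge0 _ a0)) (ger0_norm (sqr_ge0 _)).
by rewrite ge_min lexx.
Qed.

(** Dominated convergence along [a = 1 / n.+1], with the integrable bound [X ^+ 2]; monotonicity in
    [a] then covers all smaller values. *)
Lemma cubic_remainder_small e : 0 < e ->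
  exists2 a0 : R, 0 < a0 & forall a, 0 <= a <= a0 -> cubic_remainder a <= e.
Proof.
move=> e0.
pose f_ n t : \bar R := (Num.min (X 0%N t ^+ 2) (n.+1%:R^-1 * `|X 0%N t| ^+ 3))%:E.
have mX : measurable_fun setT (X 0%N) by exact: measurable_funP.
have mf n : measurable_fun setT (f_ n).
  by apply/measurable_EFinP; exact: (measurableT_comp (measurable_min_sqr_cube _) mX).
have f0 : {ae P, forall t, setT t -> f_ ^~ t @ \oo --> cst 0%E t}.
  apply: aeW => t _; apply/fine_cvgP; split; first exact: nearW.
  apply: (@squeeze_cvgr _ _ _ _ (cst 0) (fun n => harmonic n * `|X 0%N t| ^+ 3)).
  - by apply: nearW => n /=; rewrite min_sqr_cube_ge0//= ge_min lexx orbT.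
  - exact: cvg_cst.
  - by rewrite -(mul0r (`|X 0%N t| ^+ 3)); apply: cvgMr_tmp; exact: cvg_harmonic.
have fg : {ae P, forall t n, setT t -> (`|f_ n t| <= (X 0%N t ^+ 2)%:E)%E}.
  apply: aeW => t n _; rewrite /f_ lee_fin ger0_norm ?min_sqr_cube_ge0//.
  by rewrite ge_min lexx.
have [_ _] := dominated_convergence measurableT mf (measurable_cst _) f0 integrable_sqr fg.
rewrite integral0 => /fine_cvgP[_ /cvgrPdist_le/(_ e e0)[n _ /(_ n (leqnn n))/=]].
rewrite sub0r normrN => /(le_trans (ler_norm _)) hn.
exists n.+1%:R^-1 => // a /andP[a0 an]; apply: le_trans hn.
apply: le_Rintegral => //; [exact: integrable_min_sqr_cube|exact: integrable_min_sqr_cube|].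
move=> t _; rewrite le_min !ge_min lexx/=; apply/orP; right.
by rewrite ler_wpM2r ?exprn_ge0.
Qed.

End standardized_iid.

(** * Replacement of the summands one at a time *)

Section lindeberg.
Context d (T : measurableType d) (R : realType) (P : probability T R).
Variable X : nat -> {RV P >-> R}.
Hypothesis iidX : iid X.
Hypothesis EX : 'E_P[X 0%N]%E = 0%E.
Hypothesis VX : 'V_P[X 0%N]%E = 1%E.

Local Notation S := (@partial_sum _ _ _ P X).

(** The probability that [a * S k] plus an independent centered Gaussian of standard deviation [s]
    is at most [c]. *)
Definition smoothed (a c s : R) (k : nat) : R :=
  \int[P]_t gauss_cdf ((c - a * S k t) / s).

Lemma measurable_affine (a c s : R) : measurable_fun setT (fun u : R => (c - a * u) / s).
Proof.
by apply: measurable_funM => //; apply: measurable_funB => //; exact: measurable_funM.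
Qed.

Lemma integrable_smoothed (a c s : R) (k : nat) :
  P.-integrable setT (EFin \o (fun t => gauss_cdf ((c - a * S k t) / s))).
Proof.
apply: (@integrable_le_cst _ _ _ _ _ 1).
  apply: (measurableT_comp measurable_gauss_cdf).
  exact: (measurableT_comp (measurable_affine a c s) (measurable_partial_sum X k)).
by move=> t; rewrite ger0_norm ?gauss_cdf_ge0 ?gauss_cdf_le1.
Qed.

Lemma measurable_gauss_pdf : measurable_fun setT (@gauss_pdf R).
Proof. exact: measurable_normal_pdf. Qed.

Lemma gauss_pdf_moment_le : exists2 C : R, 0 < C &
  forall z : R, `|gauss_pdf z| <= C /\ `|z * gauss_pdf z| <= C.
Proof.
have [C C0 hC] := @gauss_pdf_decay R; exists C => // y.
have := hC y; have := gauss_pdf_ge0 y; rewrite normrM.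
move: (gauss_pdf y) => p p0 h; rewrite (ger0_norm p0).
split; apply: le_trans h.
  by rewrite ler_peMl// exprn_ege1// lerDl sqr_ge0.
rewrite ler_wpM2r//.
rewrite ler_norml; have := sqr_ge0 (y - 1); have := sqr_ge0 (y + 1).
by have := sqr_ge0 y => *; apply/andP; split; nra.
Qed.

(** By independence the integral factors, and the factor in [X k] has mean zero. It is applied to
    [x] and to [x ^+ 2 - 1], the two correction terms of the heat step. *)
Lemma integral_null_term (g h : R -> R) (C : R) k :
  measurable_fun setT g -> (forall x, `|g x| <= C) -> measurable_fun setT h ->
  P.-integrable setT (EFin \o (h \o X 0%N)) -> \int[P]_t h (X 0%N t) = 0 ->
  P.-integrable setT (EFin \o (fun t => h (X k t) * g (S k t))) /\
  \int[P]_t (h (X k t) * g (S k t)) = 0.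
Proof.
move=> mg gC mh ih h0.
have ind : forall A B : set R, measurable A -> measurable B ->
  P (S k @^-1` A `&` X k @^-1` B) = (P (S k @^-1` A) * P (X k @^-1` B))%E.
  exact: partial_sum_independent iidX.1 k.
have ihk := integrable_copy iidX k mh ih.
split.
  have := @integrable_boundedM _ _ _ P (S k) (X k) g h C mg gC ihk mh.
  by congr (integrable _ _); apply/funext => t /=; rewrite mulrC.
under eq_Rintegral do rewrite mulrC.
rewrite (@Rintegral_independentM _ _ _ P (S k) (X k) ind g h C)//.
by rewrite (Rintegral_copy iidX)// h0 mulr0.
Qed.

Lemma lindeberg_step : exists2 C : R, 0 < C & forall d s0 s a c k,
  0 < d -> d <= 1 -> 0 < s0 -> d <= s0 ^+ 2 -> 0 <= s -> s ^+ 2 = s0 ^+ 2 + a ^+ 2 -> 0 <= a ->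
  `|smoothed a c s0 k.+1 - smoothed a c s k| <=
  C / d ^+ 2 * (a ^+ 2 * cubic_remainder X a + a ^+ 4).
Proof.
have [C C0 hC] := @gauss_cdf_heat_step R; exists C => //.
have [C1 C10 hC1] := gauss_pdf_moment_le.
move=> e s0 s a c k e0 e1 s00 es0 s_ge0 sE a0.
pose w t := c - a * S k t.
pose g1 u := a * gauss_pdf ((c - a * u) / s0) / s0.
pose g2 u := a ^+ 2 * ((c - a * u) / s0 * gauss_pdf ((c - a * u) / s0)) / (2 * s0 ^+ 2).
pose h2 (x : R) := x ^+ 2 - 1.
have mpdf : measurable_fun setT (fun u => gauss_pdf ((c - a * u) / s0)).
  exact: (measurableT_comp measurable_gauss_pdf (measurable_affine a c s0)).
have mg1 : measurable_fun setT g1.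
  by apply: measurable_funM => //; exact: measurable_funM.
have mg2 : measurable_fun setT g2.
  apply: measurable_funM => //; apply: measurable_funM => //.
  by apply: measurable_funM => //; exact: measurable_affine.
have bg1 u : `|g1 u| <= a * C1 / s0.
  rewrite /g1 !normrM normfV (gtr0_norm s00) (ger0_norm a0).
  by rewrite ler_pM2r ?invr_gt0// ler_wpM2l// (hC1 _).1.
have bg2 u : `|g2 u| <= a ^+ 2 * C1 / (2 * s0 ^+ 2).
  have q0 : 0 < 2 * s0 ^+ 2 by rewrite mulr_gt0// exprn_gt0.
  rewrite /g2 normrM normfV (gtr0_norm q0) ler_pM2r ?invr_gt0//.
  by rewrite normrM (ger0_norm (sqr_ge0 a)) ler_wpM2l ?sqr_ge0// (hC1 _).2.
have i1 : P.-integrable setT (EFin \o (cst 1 : T -> R)).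
  by apply: (@integrable_le_cst _ _ _ _ _ 1) => // t; rewrite normr1.
have [i_g1 e_g1] := @integral_null_term g1 idfun _ k mg1 bg1 (@measurable_id _ _ _)
  (integrable_first EX VX) (first_moment EX).
have mh2 : measurable_fun setT h2.
  by apply: measurable_funB => //; exact: measurable_funX.
have ih2 : P.-integrable setT (EFin \o (h2 \o X 0%N)).
  exact: (integrableB measurableT (integrable_sqr EX VX) i1).
have eh2 : \int[P]_t h2 (X 0%N t) = 0.
  rewrite (RintegralB measurableT (integrable_sqr EX VX) i1).
  rewrite Rintegral_probability_cst /Rintegral second_moment//=.
  by rewrite subrr.
have [i_g2 e_g2] := @integral_null_term g2 h2 _ k mg2 bg2 mh2 ih2 eh2.
have iA := integrable_smoothed a c s0 k.+1; have iB := integrable_smoothed a c s k.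
have iAB := integrableB measurableT iA iB.
have iABC := integrableD measurableT iAB i_g1.
have iD := integrableD measurableT iABC i_g2.
(* The two mean-zero corrections are inserted under the integral, so that [gauss_cdf_heat_step]
   bounds the integrand pointwise. *)
have -> : smoothed a c s0 k.+1 - smoothed a c s k = \int[P]_t
  (gauss_cdf ((c - a * S k.+1 t) / s0) - gauss_cdf ((c - a * S k t) / s)
   + X k t * g1 (S k t) + h2 (X k t) * g2 (S k t)).
  by rewrite RintegralD// RintegralD// RintegralB// e_g1 e_g2 !addr0.
apply: le_trans (le_normr_Rintegral _ _) _ => //.
have im : P.-integrable setT (EFin \o (fun t => Num.min (X k t ^+ 2) (a * `|X k t| ^+ 3))).
  exact: (integrable_copy iidX k (measurable_min_sqr_cube a) (integrable_min_sqr_cube EX VX a0)).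
have im2 := integrableD measurableT (integrableZl measurableT (a ^+ 2) im)
   (integrableZl measurableT (a ^+ 4) i1).
have im3 := integrableZl measurableT (C / e ^+ 2) im2.
have -> : C / e ^+ 2 * (a ^+ 2 * cubic_remainder X a + a ^+ 4) = \int[P]_t
   (C / e ^+ 2 * (a ^+ 2 * Num.min (X k t ^+ 2) (a * `|X k t| ^+ 3) + a ^+ 4 * 1)).
  rewrite RintegralZl// RintegralD//; last exact: (integrableZl measurableT (a ^+ 4) i1).
    rewrite RintegralZl// (RintegralZl _ measurableT i1) Rintegral_probability_cst mulr1.
    by rewrite (Rintegral_copy iidX k (measurable_min_sqr_cube a) (integrable_min_sqr_cube EX VX a0)).
  exact: (integrableZl measurableT (a ^+ 2) im).
apply: le_Rintegral => //.
  exact: (integrable_abse iD).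
move=> t _; rewrite mulr1.
have := hC e s0 s (c - a * S k t) a (X k t) e0 e1 s00 es0 s_ge0 sE a0.
have -> // : c - a * S k.+1 t = c - a * S k t - a * X k t by rewrite partial_sumS; ring.
Qed.

Lemma smoothed0 a c s : smoothed a c s 0 = gauss_cdf (c / s).
Proof.
rewrite /smoothed; under eq_Rintegral do rewrite /partial_sum big_ord0 mulr0 subr0.
exact: Rintegral_probability_cst.
Qed.

Lemma lindeberg_telescope : exists2 C : R, 0 < C & forall d v a c k,
  0 < d -> d <= 1 -> d <= v -> 0 <= a ->
  `|smoothed a c (Num.sqrt v) k - gauss_cdf (c / Num.sqrt (v + k%:R * a ^+ 2))| <=
  k%:R * (C / d ^+ 2 * (a ^+ 2 * cubic_remainder X a + a ^+ 4)).
Proof.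
have [C C0 hC] := lindeberg_step; exists C => // e v a c k e0 e1 + a0.
(* The variance [v] is generalized: each removed summand raises it by [a ^+ 2], and no randomness is
   left at [k = 0]. *)
elim: k v => [|k IH] v ev.
  by rewrite smoothed0 !mul0r addr0 subrr normr0.
have v0 : 0 < v by exact: lt_le_trans ev.
have ev' : e <= v + a ^+ 2 by rewrite (le_trans ev)// lerDl sqr_ge0.
have := hC e (Num.sqrt v) (Num.sqrt (v + a ^+ 2)) a c k e0 e1.
rewrite sqrtr_gt0 !sqr_sqrtr ?sqrtr_ge0 ?addr_ge0 ?sqr_ge0 ?(ltW v0)//.
move=> /(_ v0 ev isT erefl a0) h1; have := IH (v + a ^+ 2) ev'.
have -> : v + a ^+ 2 + k%:R * a ^+ 2 = v + k.+1%:R * a ^+ 2 by rewrite -natr1; ring.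
move=> h2; have := le_trans (ler_normD _ _) (lerD h2 h1).
set A := smoothed a c _ k.+1; set B := smoothed a c _ k; set E := C / _ * _.
have -> : B - gauss_cdf (c / Num.sqrt (v + k.+1%:R * a ^+ 2)) + (A - B) =
  A - gauss_cdf (c / Num.sqrt (v + k.+1%:R * a ^+ 2)) by ring.
have -> // : k%:R * E + E = k.+1%:R * E by rewrite -natr1; ring.
Qed.

End lindeberg.

(** Here [p] is the probability to estimate, [G] its limit, [A] and [B] its smoothings at shifted
    points, [c1] and [c2] their Gaussian values, [g1] and [g2] the Gaussian tails lost by
    smoothing. *)
Lemma smoothing_sandwich (R : realFieldType) (p G A B g1 g2 c1 c2 e : R) :
  p <= A + (1 - g1) -> 1 - e / 3 <= g1 -> `|A - c1| <= e / 3 -> `|c1 - G| <= e / 3 ->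
  B - g2 <= p -> g2 <= e / 3 -> `|B - c2| <= e / 3 -> `|c2 - G| <= e / 3 ->
  `|p - G| <= e.
Proof.
rewrite !ler_norml => ? ? /andP[? ?] /andP[? ?] ? ? /andP[? ?] /andP[? ?].
by apply/andP; split; lra.
Qed.

(** * Central limit theorem, uniform over [k] with [k * a ^+ 2] close to 1 *)

Section clt_window.
Context d (T : measurableType d) (R : realType) (P : probability T R).
Variable X : nat -> {RV P >-> R}.

Local Notation S := (@partial_sum _ _ _ P X).

(** The factor stands on the right to match [a \o* f], whose distribution function at [x] is the
    probability of the preimage of this set under [f]. *)
Definition scaled_ray (a x : R) : set R := [set u | u * a <= x].

Lemma measurable_scaled_ray a x : measurable (scaled_ray a x).
Proof.
have -> : scaled_ray a x = (fun u : R => u * a) @^-1` `]-oo, x].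
  by apply/seteqP; split => u /=; rewrite in_itv.
have mf : measurable_fun setT (fun u : R => u * a) by exact: measurable_funM.
by have := mf measurableT _ (measurable_itv `]-oo, x]); rewrite setTI.
Qed.

(** On the event the smooth function is at least [gauss_cdf (h / s)], so adding
    [1 - gauss_cdf (h / s)] makes it dominate the indicator. *)
Lemma probability_scaled_sum_le a x h s k : 0 < s ->
  fine (P (S k @^-1` scaled_ray a x)) <=
  smoothed X a (x + h) s k + (1 - gauss_cdf (h / s)).
Proof.
move=> s0.
have mS : measurable (S k @^-1` scaled_ray a x).
  exact: (measurable_funPTI (S k : {mfun T >-> R}) (measurable_scaled_ray a x)).
rewrite -(Rintegral_probability_cst P (1 - _)) -RintegralD//; last 2 first.
- exact: integrable_smoothed.
- by apply: finite_measure_integrable_cst.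
have -> : fine (P (S k @^-1` scaled_ray a x)) =
    \int[P]_t \1_(S k @^-1` scaled_ray a x) t.
  by rewrite /Rintegral integral_indic// setIT.
apply: le_Rintegral => //.
- exact: integrable_indic.
- exact: (integrableD measurableT (integrable_smoothed _ _ _ _ _)
    (finite_measure_integrable_cst P _ measurableT)).
move=> t _; rewrite indicE; case: (boolP (t \in _)) => [|_]; last first.
  by rewrite addr_ge0 ?gauss_cdf_ge0// subr_ge0 gauss_cdf_le1.
rewrite inE /scaled_ray /= => Sx.
have : gauss_cdf (h / s) <= gauss_cdf ((x + h - a * S k t) / s).
  by apply: gauss_cdf_nondecreasing; rewrite ler_pM2r ?invr_gt0//; lra.
lra.
Qed.

(** Off the event the smooth function is at most [gauss_cdf (- h / s)], so subtracting this puts it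
    below the indicator. *)
Lemma probability_scaled_sum_ge a x h s k : 0 < s ->
  smoothed X a (x - h) s k - gauss_cdf (- h / s) <=
  fine (P (S k @^-1` scaled_ray a x)).
Proof.
move=> s0.
have mS : measurable (S k @^-1` scaled_ray a x).
  exact: (measurable_funPTI (S k : {mfun T >-> R}) (measurable_scaled_ray a x)).
rewrite -(Rintegral_probability_cst P (gauss_cdf _)) -RintegralB//; last 2 first.
- exact: integrable_smoothed.
- by apply: finite_measure_integrable_cst.
have -> : fine (P (S k @^-1` scaled_ray a x)) =
    \int[P]_t \1_(S k @^-1` scaled_ray a x) t.
  by rewrite /Rintegral integral_indic// setIT.
apply: le_Rintegral => //.
- exact: (integrableB measurableT (integrable_smoothed _ _ _ _ _)
    (finite_measure_integrable_cst P _ measurableT)).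
- exact: integrable_indic.
move=> t _; rewrite indicE; case: (boolP (t \in _)) => [_|].
  by rewrite /=; have := gauss_cdf_ge0 (- h / s); have := gauss_cdf_le1 ((x - h - a * S k t) / s); lra.
rewrite notin_setE /scaled_ray /= => /negP; rewrite -ltNge => Sx.
have : gauss_cdf ((x - h - a * S k t) / s) <= gauss_cdf (- h / s).
  by apply: gauss_cdf_nondecreasing; rewrite ler_pM2r ?invr_gt0//; lra.
rewrite subr_le0; exact.
Qed.

Hypothesis iidX : iid X.
Hypothesis EX : 'E_P[X 0%N]%E = 0%E.
Hypothesis VX : 'V_P[X 0%N]%E = 1%E.

Lemma clt_window (x e : R) : 0 < e -> exists eps a0 : R, [/\ 0 < eps, 0 < a0 &
  forall a k, 0 < a -> a <= a0 -> `|k%:R * a ^+ 2 - 1| <= eps ->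
  `|fine (P (S k @^-1` scaled_ray a x)) - gauss_cdf x| <= e].
Proof.
move=> e0; have e3 : 0 < e / 3 by rewrite divr_gt0.
have [C C0 hC] := lindeberg_telescope iidX EX VX.
have [eta eta0 heta] : exists2 eta : R, 0 < eta &
    forall y, `|y - x| <= eta -> `|gauss_cdf y - gauss_cdf x| <= e / 3.
  have /cvgrPdist_le/(_ _ e3)/nbhs_ballP[r /= r0 hr] := @continuous_gauss_cdf R x.
  exists (r / 2); first by rewrite divr_gt0.
  move=> y yr; rewrite distrC; apply: hr; rewrite /ball/= distrC.
  by apply: le_lt_trans yr _; rewrite ltr_pdivrMr// ltr_pMr// ltr1n.
have [M M0 hM] := gauss_cdf_tails e3.
(* [kap] bounds the window, the shift of [x] and the smoothing variance [v]. The bound [4^-1] keeps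
   [q] above 1/2; the other one keeps [(x + h) / q] within [eta], the modulus of continuity at
   [x]. *)
pose kap := Num.min 4^-1 (eta / (4 * (1 + `|x|))).
have x0 : 0 < 1 + `|x| by rewrite ltr_pwDl.
have k0 : 0 < kap by rewrite lt_min invr_gt0 ltr0n/= divr_gt0// mulr_gt0.
have k4 : kap <= 4^-1 by rewrite ge_min lexx.
have keta : 4 * (1 + `|x|) * kap <= eta.
  by rewrite mulrC -ler_pdivlMr ?mulr_gt0// ge_min lexx orbT.
(* Chosen so that the shift [kap] is at least [M] standard deviations of the smoothing Gaussian. *)
pose v := Num.min kap ((kap / M) ^+ 2).
have kM : 0 < kap / M by rewrite divr_gt0.
have v0 : 0 < v by rewrite lt_min k0 exprn_gt0.
have vk : v <= kap by rewrite ge_min lexx.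
have v1 : v <= 1 by lra.
have sv0 : 0 < Num.sqrt v by rewrite sqrtr_gt0.
have Mv : M <= kap / Num.sqrt v.
  rewrite ler_pdivlMr// mulrC -ler_pdivlMr//.
  by rewrite -(ler_sqr (x := Num.sqrt v)) ?nnegrE ?sqrtr_ge0 ?(ltW kM)// sqr_sqrtr ?(ltW v0)// ge_min lexx orbT.
(* The remainder and [a ^+ 2] will each be at most [b]; with [k%:R * a ^+ 2 <= 2] the telescoped
   error is then at most [e / 3]. *)
pose b := e / 3 * v ^+ 2 / (4 * C).
have b0 : 0 < b by rewrite divr_gt0 ?mulr_gt0// exprn_gt0.
have [a1 a10 ha1] := cubic_remainder_small EX VX b0.
exists kap, (Num.min a1 (Num.min 1 b)); split=> //.
  by rewrite !lt_min a10 b0 ltr01.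
move=> a k a0 + ka; rewrite !le_min => /and3P[aa1 a_1 ab].
pose q := Num.sqrt (v + k%:R * a ^+ 2).
have ka12 : 1 - kap <= k%:R * a ^+ 2 <= 1 + kap.
  by move: ka; rewrite ler_norml => /andP[? ?]; apply/andP; split; lra.
have q2 : q ^+ 2 = v + k%:R * a ^+ 2.
  by rewrite sqr_sqrtr//; move: ka12 => /andP[? ?]; lra.
have q0 : 0 <= q by exact: sqrtr_ge0.
have q1 : `|q - 1| <= 2 * kap.
  have : `|q ^+ 2 - 1| <= 2 * kap.
    by rewrite q2 ler_norml; move: ka12 => /andP[? ?]; apply/andP; split; lra.
  apply: le_trans; rewrite subr_sqr_1 normrM ler_peMr// ger0_norm; lra.
have qge : 2^-1 <= q by move: q1; rewrite ler_norml => /andP[? ?]; lra.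
have close (h : R) : `|h| <= kap -> `|gauss_cdf ((x + h) / q) - gauss_cdf x| <= e / 3.
  move=> hk; apply: heta; apply: le_trans keta.
  have qn0 : q != 0 by rewrite gt_eqF//; lra.
  have -> : (x + h) / q - x = (h - x * (q - 1)) / q by field.
  rewrite normrM normfV (ger0_norm q0) ler_pdivrMr; last lra.
  apply: le_trans (ler_normB _ _) _; rewrite normrM.
  have : `|x| * `|q - 1| <= `|x| * (2 * kap) by rewrite ler_wpM2l.
  have : 0 <= `|x| * kap by rewrite mulr_ge0// ltW.
  have := normr_ge0 x; nra.
have err (c : R) : `|smoothed X a c (Num.sqrt v) k - gauss_cdf (c / q)| <= e / 3.
  apply: le_trans (hC v v a c k v0 v1 (lexx _) (ltW a0)) _.
  have rb : cubic_remainder X a <= b by apply: ha1; rewrite ltW.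
  have a2 : a ^+ 2 <= b by rewrite expr2 (le_trans _ ab)// ler_piMr// ltW.
  have -> : k%:R * (C / v ^+ 2 * (a ^+ 2 * cubic_remainder X a + a ^+ 4)) =
    (k%:R * a ^+ 2) * (C / v ^+ 2 * (cubic_remainder X a + a ^+ 2)) by ring.
  have hb : C / v ^+ 2 * (2 * b) = e / 3 / 2.
    by rewrite /b; field; rewrite !gt_eqF.
  have Cv : 0 < C / v ^+ 2 by rewrite divr_gt0// exprn_gt0.
  apply: (@le_trans _ _ (2 * (C / v ^+ 2 * (2 * b)))); last by rewrite hb; lra.
  apply: (@le_trans _ _ ((k%:R * a ^+ 2) * (C / v ^+ 2 * (2 * b)))).
    by apply: ler_wpM2l; [rewrite mulr_ge0 ?sqr_ge0|apply: ler_wpM2l; [exact: ltW|lra]].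
  apply: ler_wpM2r; last by move: ka12 => /andP[? ?]; lra.
  by rewrite mulr_ge0 ?(ltW Cv)// mulr_ge0// ltW.
have up := probability_scaled_sum_le a x kap k sv0.
have lo := probability_scaled_sum_ge a x kap k sv0.
have t1 := (hM _).1 Mv.
have t2 : gauss_cdf (- kap / Num.sqrt v) <= e / 3.
  by apply: (hM _).2; rewrite mulNr lerN2.
have ca : `|gauss_cdf ((x + kap) / q) - gauss_cdf x| <= e / 3.
  by apply: close; rewrite gtr0_norm.
have cb : `|gauss_cdf ((x - kap) / q) - gauss_cdf x| <= e / 3.
  by apply: close; rewrite normrN gtr0_norm.
exact: smoothing_sandwich up t1 (err _) ca lo t2 (err _) cb.
Qed.

End clt_window.

(** * Concentration of the COMP distribution *)

Section comp_concentration.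
Context {R : realType}.

Lemma comp_pmfS (lambda eta : R) (j : nat) :
  comp_pmf lambda eta j.+1 * (j.+1%:R `^ eta) = lambda * comp_pmf lambda eta j.
Proof.
rewrite /comp_pmf /comp_weight factS natrM powRM// exprS.
have jn0 : (j.+1%:R : R) `^ eta != 0 by rewrite gt_eqF// powR_gt0.
have fn0 : (j`!%:R : R) `^ eta != 0 by rewrite gt_eqF// powR_gt0// ltr0n fact_gt0.
set H := (comp_normalizer _ _)^-1.
by field; rewrite jn0 fn0.
Qed.

Context d (T : measurableType d) (P : probability T R) (K : {RV P >-> nat}).

(** Termwise comparison of the series over [D]. Taking [id] and [S] compares a tail with its shift
    by one. *)
Lemma le_probability_image (D : set nat) (f g : nat -> nat) (r : R) :
  injective f -> injective g -> 0 <= r ->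
  (forall j, D j -> (P (K @^-1` [set f j]) <= r%:E * P (K @^-1` [set g j]))%E) ->
  (P (K @^-1` (f @` D)) <= r%:E * P (K @^-1` (g @` D)))%E.
Proof.
move=> fI gI r0 fg.
have E (h : nat -> nat) : injective h ->
    P (K @^-1` (h @` D)) = (\sum_(0 <= j <oo | j \in D) P (K @^-1` [set h j]))%E.
  move=> hI; rewrite -measure_bigcup//.
  - congr (P _); apply/seteqP; split => [t [j Dj /= hj]|t [j Dj /= hj]];
      by exists j => //=; rewrite hj.
  - by move=> j _; exact: measurable_funPTI.
  - by move=> i j _ _ [t [/= hi hj]]; apply: hI; rewrite -hi -hj.
rewrite E// E// -nneseriesZl//.
apply: lee_nneseries => // j.
by move=> Dj; apply: fg; exact/set_mem.
Qed.

(** Each shift of the tail by one gains a factor [r]. *)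
Lemma upper_tail_geometric (n N : nat) (r : R) : 0 <= r ->
  (forall j, (n <= j)%N -> (P (K @^-1` [set j.+1]) <= r%:E * P (K @^-1` [set j]))%E) ->
  (P (K @^-1` [set j | (n + N <= j)%N]) <= (r ^+ N)%:E)%E.
Proof.
move=> r0 hr; elim: N => [|N IH].
  by rewrite expr0 probability_le1//; exact: measurable_funPTI.
have /= := @le_probability_image [set j | (n + N <= j)%N] S id r succn_inj (@inj_id nat) r0 _.
rewrite image_id exprS EFinM => h.
have -> : [set j | (n + N.+1 <= j)%N] = S @` [set j | (n + N <= j)%N].
  apply/seteqP; split => [[|j]/=|_ [j /= nj <-]]; rewrite ?addnS//.
  by move=> nj; exists j.
apply: le_trans (h _) _ => [j /= nj|]; first by apply: hr; exact: leq_trans (leq_addr _ _) nj.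
by rewrite lee_wpmul2l// lee_fin.
Qed.

(** The shift of the values below [n] lies below [n.+1], so the cutoff climbs during the induction
    and the ratio bound is required up to [n + N]. *)
Lemma lower_tail_geometric (n N : nat) (r : R) : 0 <= r ->
  (forall j, (j < n + N)%N -> (P (K @^-1` [set j]) <= r%:E * P (K @^-1` [set j.+1]))%E) ->
  (P (K @^-1` [set j | (j < n)%N]) <= (r ^+ N)%:E)%E.
Proof.
move=> r0; elim: N n => [|N IH] n hr.
  by rewrite expr0 probability_le1//; exact: measurable_funPTI.
have /= := @le_probability_image [set j | (j < n)%N] id S r (@inj_id nat) succn_inj r0 _.
rewrite image_id exprS EFinM => h.
apply: le_trans (h _) _ => [j /= nj|]; first by apply: hr; exact: leq_trans nj (leq_addr _ _).
rewrite lee_wpmul2l// ?lee_fin//; apply: le_trans (IH n.+1 _); last by rewrite addSnnS.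
apply: le_measure; rewrite ?inE; [exact: measurable_funPTI|exact: measurable_funPTI|].
by move=> t /= [j jn <-].
Qed.

End comp_concentration.

Section comp_concentration_bound.
Context {R : realType} (lambda eta : R).
Context d (T : measurableType d) (P : probability T R) (K : {RV P >-> nat}).
Hypotheses (lambda0 : 0 < lambda) (eta0 : 0 < eta).
Hypothesis hK : comp_distributed K lambda eta.

Let q := lambda `^ (1 / eta).

Let q0 : 0 < q. Proof. exact: powR_gt0. Qed.

Let qE : q `^ eta = lambda.
Proof. by rewrite /q -powRrM mul1r mulVf ?gt_eqF// powRr1// ltW. Qed.

Let pmfE j : P (K @^-1` [set j]) = (comp_pmf lambda eta j)%:E.
Proof. exact: hK. Qed.

Let pmf_ge0 j : 0 <= comp_pmf lambda eta j.
Proof. by rewrite -lee_fin -pmfE. Qed.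

Lemma comp_ratio_le (rho : R) j : 0 <= rho -> q <= rho * j.+1%:R ->
  (P (K @^-1` [set j.+1]) <= (rho `^ eta)%:E * P (K @^-1` [set j]))%E.
Proof.
move=> rho0 qj; rewrite !pmfE -EFinM lee_fin.
have j0 : 0 < (j.+1%:R : R) `^ eta by rewrite powR_gt0.
have h : lambda <= rho `^ eta * (j.+1%:R `^ eta).
  rewrite -powRM// -[leLHS]qE; apply: ge0_ler_powR; rewrite ?nnegrE//; [exact: ltW|exact: ltW|exact: mulr_ge0].
by rewrite -(ler_pM2r j0) comp_pmfS mulrAC ler_wpM2r.
Qed.

Lemma comp_ratio_ge (rho : R) j : 0 <= rho -> j.+1%:R <= rho * q ->
  (P (K @^-1` [set j]) <= (rho `^ eta)%:E * P (K @^-1` [set j.+1]))%E.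
Proof.
move=> rho0 qj; rewrite !pmfE -EFinM lee_fin.
have h : j.+1%:R `^ eta <= rho `^ eta * lambda.
  rewrite -[X in _ * X]qE -powRM ?(ltW q0)//.
  by apply: ge0_ler_powR; rewrite ?nnegrE//; [exact: ltW|rewrite mulr_ge0// ltW].
rewrite -(ler_pM2l lambda0) -comp_pmfS.
set p := comp_pmf _ _ _; have -> : lambda * (rho `^ eta * p) = p * (rho `^ eta * lambda).
  by ring.
by rewrite ler_wpM2l ?pmf_ge0.
Qed.

(** The ratio bounds hold beyond relative distance [delta] from [q]. Between [delta] and [2 * delta]
    there is room for [N] geometric steps, the extra 2 absorbing the rounding. *)
Lemma comp_tails_le (delta : R) (N : nat) : 0 < delta -> delta <= 1 / 2 ->
  N%:R + 2 <= delta * q ->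
  (P (K @^-1` [set j : nat | (2 * delta < `|j%:R / q - 1|)%R]) <=
   ((Num.max (1 + delta)^-1 (1 - delta)) `^ eta ^+ N *+ 2)%R%:E)%E.
Proof.
move=> delta0 delta12 Nq; set rho := Num.max _ _.
have d1 : 0 < 1 + delta by rewrite addr_gt0.
have rho0 : 0 <= rho by rewrite le_max invr_ge0 (ltW d1).
have r0 : 0 <= rho `^ eta by exact: powR_ge0.
pose n1 := (Num.truncn ((1 + delta) * q)).+1.
pose n2 := Num.truncn ((1 - delta) * q).
have qd1 : 0 <= (1 + delta) * q by rewrite mulr_ge0 ?(ltW d1) ?(ltW q0).
have dq : delta * q <= (1 - delta) * q by rewrite ler_pM2r//; lra.
have N0 : 0 <= (N%:R : R) by [].
have qd2 : 0 <= (1 - delta) * q by lra.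
have /andP[n1le n1gt] := truncn_itv qd1.
have /andP[n2le n2gt] := truncn_itv qd2.
(* This makes the natural subtraction [n2 - N] exact. *)
have Nn2 : (N <= n2)%N by rewrite -ltnS -(ltr_nat R); apply: le_lt_trans n2gt; lra.
have up := @upper_tail_geometric R _ _ P K n1 N _ r0 _.
have lo := @lower_tail_geometric R _ _ P K (n2 - N) N _ r0 _.
rewrite mulr2n EFinD.
apply: (@le_trans _ _ (P (K @^-1` [set j | (n1 + N <= j)%N]) +
                       P (K @^-1` [set j | (j < n2 - N)%N]))%E); last first.
  apply: leeD; [apply: up => j n1j|apply: lo => j; rewrite subnK// => jn2].
    apply: comp_ratio_le => //; apply: (@le_trans _ _ ((1 + delta)^-1 * j.+1%:R)).
      rewrite ler_pdivlMl//; apply: le_trans (ltW n1gt) _.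
      by rewrite ler_nat ltnW.
    by rewrite ler_wpM2r// le_max lexx.
  apply: comp_ratio_ge => //; apply: (@le_trans _ _ ((1 - delta) * q)).
    by apply: le_trans n2le; rewrite ler_nat.
  by rewrite ler_wpM2r ?(ltW q0)// le_max lexx orbT.
have mK (B : set nat) : measurable (K @^-1` B) by exact: measurable_funPTI.
apply: le_trans (measureU2 _ _ _) => //.
apply: le_measure; rewrite ?inE//; first exact: measurableU.
move=> t /=; move: (K t) => j; rewrite ltr_normr => /orP[h|h]; [left|right].
- have : (1 + 2 * delta) * q < j%:R by rewrite -ltr_pdivlMr//; lra.
  move=> {}h; rewrite -(ler_nat R) natrD /n1 -natr1; apply: ltW; apply: le_lt_trans h.
  by move: n1le; lra.
- have : j%:R < (1 - 2 * delta) * q by rewrite -ltr_pdivrMr//; lra.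
  move=> {}h; rewrite -(ltr_nat R) natrB//; move: n2gt; rewrite -natr1 -/n2; lra.
Qed.

End comp_concentration_bound.

(** The decay rate depends only on [delta] and [eta], so [N] is fixed first; [lambda] is then taken
    large enough for [N] steps to fit in the margin. *)
Lemma comp_concentration (R : realType) (eta eps e : R) :
  0 < eta -> 0 < eps -> 0 < e -> exists lambda0 : R, 0 < lambda0 /\
  forall lambda, lambda0 <= lambda ->
  forall d (T : measurableType d) (P : probability T R) (K : {RV P >-> nat}),
  comp_distributed K lambda eta ->
  (P (K @^-1` [set j : nat | (eps < `|j%:R / lambda `^ (1 / eta) - 1|)%R]) <= e%:E)%E.
Proof.
move=> eta0 eps0 e0.
pose delta := Num.min (1 / 2) (eps / 2).
have delta0 : 0 < delta by rewrite lt_min !divr_gt0.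
have delta1 : delta <= 1 / 2 by rewrite ge_min lexx.
have delta2 : 2 * delta <= eps.
  by rewrite mulrC -ler_pdivlMr// ge_min lexx orbT.
pose rho := Num.max (1 + delta)^-1 (1 - delta).
have rho0 : 0 < rho by rewrite lt_max invr_gt0 addr_gt0.
have rho1 : rho < 1 by rewrite gt_max invf_lt1 ?addr_gt0//; apply/andP; split; lra.
pose r := rho `^ eta.
have r0 : 0 <= r by exact: powR_ge0.
have r1 : r < 1.
  have <- : (1 : R) `^ eta = 1 by rewrite powR1.
  by rewrite /r gt0_ltr_powR ?nnegrE ?ler01// ltW.
have [N rN] : exists N, r ^+ N *+ 2 <= e.
  have : `|r| < 1 by rewrite ger0_norm.
  move=> /cvg_expr/cvgrPdist_le/(_ (e / 2))[|N _ /(_ N (leqnn N))/=].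
    by rewrite divr_gt0.
  rewrite sub0r normrN ger0_norm ?exprn_ge0// => h.
  by exists N; rewrite -mulr_natr -ler_pdivlMr.
have c0 : 0 < (N%:R + 2) / delta by rewrite divr_gt0// ltr_wpDl.
exists (((N%:R + 2) / delta) `^ eta); split; first exact: powR_gt0.
move=> lambda hl d T P K hK.
have lambda0 : 0 < lambda by apply: lt_le_trans hl; exact: powR_gt0.
have Nq : N%:R + 2 <= delta * lambda `^ (1 / eta).
  rewrite mulrC -ler_pdivrMr//.
  have -> : (N%:R + 2) / delta = (((N%:R + 2) / delta) `^ eta) `^ (1 / eta).
    by rewrite -powRrM mul1r mulfV ?gt_eqF// powRr1// ltW.
  by rewrite ge0_ler_powR ?nnegrE ?powR_ge0 ?(ltW lambda0)// divr_ge0// ltW.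
have := comp_tails_le lambda0 eta0 hK delta0 delta1 Nq.
move=> h; apply: le_trans (le_trans h _); last by rewrite lee_fin.
apply: le_measure; rewrite ?inE; [exact: measurable_funPTI|exact: measurable_funPTI|].
by move=> t /= ; exact: le_lt_trans.
Qed.

(** * Random index *)

Section random_index.
Context d (T : measurableType d) (R : realType) (P : probability T R).

(** The event is split along the values of [K]: those in [D] have total mass at most 1, the others
    are bounded by their own probability. *)
Lemma probability_mixture_le (K : {RV P >-> nat}) (A : set T) (D : set nat) (c : R) :
  measurable A -> 0 <= c ->
  (forall j, D j -> (P (K @^-1` [set j] `&` A) <= c%:E * P (K @^-1` [set j]))%E) ->
  (P A <= c%:E + P (K @^-1` (~` D)))%E.
Proof.
move=> mA c0 hc.
have mK (B : set nat) : measurable (K @^-1` B) by exact: measurable_funPTI.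
have mKA (B : set nat) : measurable (K @^-1` B `&` A) by exact: measurableI.
have tK : trivIset D (fun j => K @^-1` [set j]).
  by move=> i j _ _ [t [/= hi hj]]; rewrite -hi -hj.
apply: (@le_trans _ _ (P (K @^-1` D `&` A) + P (K @^-1` (~` D)))%E).
  apply: le_trans (measureU2 _ _ _) => //.
  apply: le_measure; rewrite ?inE//; first exact: measurableU.
  by move=> t At; have [Dt|nDt] := pselect (D (K t)); [left|right].
apply: leeD => //.
have -> : P (K @^-1` D `&` A) = (\sum_(0 <= j <oo | j \in D) P (K @^-1` [set j] `&` A))%E.
  rewrite -measure_bigcup//.
    congr (P _); apply/seteqP; split => [t [Dt At]|t [j Dj [/= Kt At]]].
      by exists (K t).
    by split => //; rewrite /= Kt.
  by apply: trivIset_setIr.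
have sumD : (\sum_(0 <= j <oo | j \in D) P (K @^-1` [set j]) <= 1)%E.
  rewrite -measure_bigcup//; apply: probability_le1.
  by apply: bigcup_measurable => j _.
apply: (@le_trans _ _ (\sum_(0 <= j <oo | j \in D) (c%:E * P (K @^-1` [set j])))%E).
  by apply: lee_nneseries => // j Dj; apply: hc; exact/set_mem.
rewrite nneseriesZl// -[leRHS]mule1.
by apply: lee_wpmul2l; rewrite ?lee_fin.
Qed.

Lemma random_sum_close (X : nat -> {RV P >-> R}) (K : {RV P >-> nat}) (a x G e : R) (D : set nat) :
  independent_of_family K X -> 0 <= G <= 1 -> 0 <= e ->
  (forall j, D j -> `|fine (P (partial_sum X j @^-1` scaled_ray a x)) - G| <= e) ->
  (P (K @^-1` (~` D)) <= e%:E)%E ->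
  `|fine (P (random_sum X K @^-1` scaled_ray a x)) - G| <= 2 * e.
Proof.
move=> KX /andP[G0 G1] e0 hD bad.
have mray := measurable_scaled_ray a x.
have mS j (B : set R) : measurable B -> measurable (partial_sum X j @^-1` B).
  by move=> mB; exact: (measurable_funPTI (partial_sum X j : {mfun T >-> R}) mB).
set A := random_sum X K @^-1` _.
have mA : measurable A.
  exact: (measurable_funPTI (random_sum X K : {mfun T >-> R}) mray).
have KA (B : set R) j : K @^-1` [set j] `&` random_sum X K @^-1` B =
    K @^-1` [set j] `&` partial_sum X j @^-1` B.
  by apply/seteqP; split => t [/= Kt] h; split => //; move: h; rewrite /random_sum /partial_sum Kt.
have up : (P A <= (G + e)%:E + P (K @^-1` (~` D)))%E.
  apply: probability_mixture_le => // [|j Dj]; first by rewrite addr_ge0.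
  rewrite KA independent_partial_sum// muleC; apply: lee_wpmul2r => //.
  rewrite -(@fineK _ (P _)) ?fin_num_measure//; last exact: (mS _ _ mray).
  by rewrite lee_fin -lerBlDl; exact: le_trans (ler_norm _) (hD j Dj).
(* The lower bound on [P A] is the mixture bound for the complement. *)
have lo : (P (~` A) <= (1 - G + e)%:E + P (K @^-1` (~` D)))%E.
  apply: probability_mixture_le => // [||j Dj]; first exact: measurableC.
    by rewrite addr_ge0// subr_ge0.
  have -> : ~` A = random_sum X K @^-1` (~` scaled_ray a x) by [].
  rewrite KA independent_partial_sum//; last exact: measurableC.
  rewrite muleC; apply: lee_wpmul2r => //.
  rewrite preimage_setC probability_setC; last exact: (mS _ _ mray).
  rewrite -(@fineK _ (P (_ @^-1` _))) ?fin_num_measure//; last exact: (mS _ _ mray).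
  rewrite -EFinB lee_fin; have := hD j Dj; rewrite ler_norml => /andP[? ?]; lra.
have PA : P A = (fine (P A))%:E by rewrite fineK// fin_num_measure.
have {}up := le_trans up (leeD (lexx _) bad); have {}lo := le_trans lo (leeD (lexx _) bad).
rewrite PA -EFinD lee_fin in up.
rewrite probability_setC// PA -EFinB -EFinD lee_fin in lo.
by rewrite ler_norml; apply/andP; split; lra.
Qed.

End random_index.

(** * Convergence of the scaled random sum *)

Theorem proposition5p2 (R : realType) (d : measure_display)
    (T : measurableType d) (P : probability T R) (eta : R)
    (X : nat -> {RV P >-> R}) (K : R -> {RV P >-> nat}) :
  0 < eta ->
  iid X ->
  'E_P[X 0%N]%E = 0%E ->
  'V_P[X 0%N]%E = 1%E ->
  (forall lambda : R, 0 < lambda -> comp_distributed (K lambda) lambda eta) ->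
  (forall lambda : R, 0 < lambda -> independent_of_family (K lambda) X) ->
  cvg_in_distribution (pinfty_nbhs R)
    (fun lambda : R =>
       (lambda `^ (- (1 / (2 * eta))) \o* random_sum X (K lambda) : {RV P >-> R}))
    (normal_prob (0 : R) (1 : R)).
Proof.
move=> eta0 iidX EX VX compK indK x _.
rewrite [X in _ --> X](_ : _ = (gauss_cdf x)%:E); last exact: (esym (gauss_cdfE x)).
apply/fine_cvgP; split; first by apply: nearW => l; rewrite fin_num_measure.
apply/cvgrPdist_le => e e0; have e2 : 0 < e / 2 by rewrite divr_gt0.
have [eps [a0 [eps0 a00 window]]] := clt_window iidX EX VX x e2.
have [l0 [l00 conc]] := comp_concentration eta0 eps0 e2.
(* The value of [lambda] at which the scaling factor equals [a0]; it decreases afterwards. *)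
pose r := a0 `^ (- (2 * eta)).
near=> l.
have ll0 : l0 <= l by near: l; apply: nbhs_pinfty_ge; rewrite num_real.
have lr : r <= l by near: l; apply: nbhs_pinfty_ge; rewrite num_real.
have lgt0 : 0 < l by exact: lt_le_trans ll0.
have r0 : 0 < r by exact: powR_gt0.
set a := l `^ (- (1 / (2 * eta))).
have agt0 : 0 < a by rewrite powR_gt0.
have eta2 : 2 * eta != 0 by rewrite gt_eqF// mulr_gt0.
(* Hence [j%:R * a ^+ 2] is [j%:R / q]: the window of the central limit theorem is the concentration
   event of [K]. *)
have aE : a ^+ 2 = (l `^ (1 / eta))^-1.
  rewrite -powR_mulrn ?(ltW agt0)// /a -powRrM -powRN; congr (_ `^ _).
  by field; rewrite gt_eqF.
have aa0 : a <= a0.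
  have -> : a0 = r `^ (- (1 / (2 * eta))).
    by rewrite /r -powRrM mulrNN mul1r mulfV// powRr1// ltW.
  rewrite /a !powRN lef_pV2 ?posrE ?powR_gt0//.
  apply: ge0_ler_powR; rewrite ?nnegrE ?(ltW lgt0) ?(ltW r0)//.
  by rewrite ltW// divr_gt0// mulr_gt0.
rewrite distrC.
have -> : e = 2 * (e / 2) by field.
apply: (@random_sum_close _ _ _ P X (K l) a x _ _
  [set j | `|j%:R / l `^ (1 / eta) - 1| <= eps]).
- exact: indK.
- by rewrite gauss_cdf_ge0 gauss_cdf_le1.
- exact: ltW.
- by move=> j /= hj; apply: window => //; rewrite aE.
- have -> : ~` [set j : nat | `|j%:R / l `^ (1 / eta) - 1| <= eps] =
      [set j : nat | eps < `|j%:R / l `^ (1 / eta) - 1|].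
    by apply/seteqP; split => j /=; rewrite ltNge => /negP.
  exact/conc/compK.
Unshelve. all: by end_near. Qed.
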